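(* Let $G$ be a simple connected graph on $n$ vertices, where $n\ge 4$. Then $$ {\rm SJ}(G)\ge 2\sqrt{\frac{n}{n-1}}\,. $$
   Context: For a simple connected graph $G$ with $n$ vertices and $m$ edges, ${\rm dist}_G(u,v)$ denotes the distance between vertices $u,v$, and the transmission of a vertex $u$ is $w(u)=\sum_{x\in V(G)}{\rm dist}_G(u,x)$. The sum-Balaban index of $G$ is $$ {\rm SJ}(G)=\frac{m}{m-n+2}\sum_{uv\in E(G)}\frac{1}{\sqrt{w(u)+w(v)}}. $$ *)

(* Defs.v *)
From mathcomp Require Import all_boot all_order all_algebra.
From mathcomp Require Import reals.
Set Implicit Arguments.
Unset Strict Implicit.
Unset Printing Implicit Defensive.
Import Order.TTheory GRing.Theory Num.Theory.

Section Graph.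
Variables (T : finType) (e : rel T).

(* A simple graph on T is a symmetric irreflexive adjacency relation e; an edge
   uv is the unordered pair [set u; v], so that each edge is counted once. *)
Definition edges : {set {set T}} :=
  [set [set uv.1; uv.2] | uv : T * T & e uv.1 uv.2].

Definition connected_graph : Prop := forall u v : T, connect e u v.

Definition has_walk (k : nat) (u v : T) : bool :=
  [exists p : k.-tuple T, path e u p && (last u p == v)].

(* The least length of a walk from u to v. A shortest walk has length < #|T|;
   the value is the junk #|T| when v is not reachable from u (see distP). *)
Definition dist (u v : T) : nat :=
  find (fun k => has_walk k u v) (iota 0 #|T|).

Definition transmission (u : T) : nat := \sum_(x : T) dist u x.

Lemma has_walkP k u v :
  reflect (exists p, [/\ size p = k, path e u p & last u p = v])
          (has_walk k u v).
Proof.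
apply: (iffP existsP) => [[p /andP[pp /eqP lp]]|[p [sp pp lp]]].
  by exists p; rewrite size_tuple.
by exists (tcast sp (in_tuple p)); rewrite val_tcast /= pp lp eqxx.
Qed.

Lemma distP u v : connect e u v ->
  has_walk (dist u v) u v /\ (forall k, has_walk k u v -> dist u v <= k).
Proof.
move=> /connectP[p0 p0P ->{v}].
case/shortenP: p0P => p pp up _; set v := last u p.
have sp : size p < #|T| by have := max_card (mem (u :: p)); rewrite (card_uniqP up).
have hw : has (fun k => has_walk k u v) (iota 0 #|T|).
  apply/hasP; exists (size p); first by rewrite mem_iota.
  by apply/has_walkP; exists p.
have dl : dist u v < #|T| by move: (hw); rewrite has_find size_iota.
split; first by have := nth_find 0 hw; rewrite nth_iota.
move=> k hk; rewrite leqNgt; apply/negP => lt_k.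
have := before_find 0 lt_k.
by rewrite nth_iota ?add0n ?hk // (ltn_trans lt_k).
Qed.

Lemma in_edges u v : symmetric e -> ([set u; v] \in edges) = e u v.
Proof.
move=> se; apply/imsetP/idP => [[[a b]]|euv]; last by exists (u, v); rewrite ?inE.
rewrite inE /= => eab /setP E.
have := E u; have := E v; have := E a; have := E b.
rewrite !inE !eqxx !orbT /= => /orP[]/eqP Eb /orP[]/eqP Ea /esym/orP[]/eqP Ev /esym/orP[]/eqP Eu;
by have eba : e b a; [rewrite se | congruence].
Qed.

End Graph.

Local Open Scope ring_scope.

(* For an edge A = [set u; v] with u != v, \sum_(x in A) transmission e x is
   w(u) + w(v). The subtraction m - n + 2 is performed in R, not truncated. *)
Definition sum_balaban (R : realType) (T : finType) (e : rel T) : R :=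
  let m : R := #|edges e|%:R in
  let n : R := #|T|%:R in
  m / (m - n + 2) *
  \sum_(A in edges e) 1 / Num.sqrt (\sum_(x in A) transmission e x)%N%:R.

Lemma sum_edge_transmission (T : finType) (e : rel T) u v :
  irreflexive e -> e u v ->
  (\sum_(x in [set u; v]) transmission e x = transmission e u + transmission e v)%N.
Proof.
move=> ie euv; have nuv : u != v by apply: contraTneq euv => ->; rewrite ie.
by rewrite big_setU1 ?big_set1 // inE.
Qed.

(* Main.v *)
Require Import Defs.
From mathcomp Require Import all_boot all_order all_algebra.
From mathcomp Require Import reals.
From mathcomp Require Import zify ring lra.
Set Implicit Arguments.
Unset Strict Implicit.
Unset Printing Implicit Defensive.
Import Order.TTheory GRing.Theory Num.Theory.
Local Open Scope ring_scope.

(** Every vertex has transmission at most n(n-1)/2, because fewer than n-k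
    vertices lie at distance more than k from it; so every summand is at least
    1/sqrt(n(n-1)) and SJ(G) >= m^2 / ((m-n+2) sqrt(n(n-1))). Finally
    m^2 - 2n(m-n+2) = (m-n)^2 + n(n-4) >= 0 when n >= 4, and m-n+2 > 0 because
    joining each vertex to a predecessor on a shortest path from a fixed root
    gives n-1 distinct edges. *)

Section ConnectedGraph.
Local Open Scope nat_scope.
Variables (T : finType) (e : rel T).
Hypothesis e_conn : connected_graph e.

Lemma dist_self u : dist e u u = 0.
Proof.
have [_ min_uu] := distP (e_conn u u).
by apply/eqP; rewrite -leqn0; apply/min_uu/has_walkP; exists [::].
Qed.

Lemma dist_gt0 u v : v != u -> 0 < dist e u v.
Proof.
move=> nvu; have [/has_walkP[p [sp _ lp]] _] := distP (e_conn u v).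
rewrite -sp; case: p lp {sp} => //= uv.
by rewrite uv eqxx in nvu.
Qed.

(** The witness is the penultimate vertex of a shortest walk: the truncated walk bounds its distance
    above, and extending a shortest walk to it by [v] bounds it below. *)
Lemma dist_pred u v : 0 < dist e u v ->
  exists2 w, e w v & dist e u v = (dist e u w).+1.
Proof.
move=> d_gt0; have [/has_walkP[p [sp pp lp]] min_v] := distP (e_conn u v).
case/lastP: p sp pp lp => [|p x] sp pp lp; first by rewrite -sp in d_gt0.
rewrite last_rcons in lp; subst x.
move: pp; rewrite rcons_path => /andP[pp ew]; exists (last u p) => //.
have [/has_walkP[q [sq pq lq]] min_w] := distP (e_conn u (last u p)).
apply/eqP; rewrite eqn_leq; apply/andP; split.
  apply/min_v/has_walkP; exists (rcons q v).
  by rewrite size_rcons sq rcons_path pq lq ew last_rcons.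
rewrite -sp size_rcons ltnS; apply/min_w/has_walkP.
by exists p.
Qed.

Lemma dist_attained u v k : k <= dist e u v -> exists w, dist e u w = k.
Proof.
move=> /subnK; move: (_ - k) => i.
elim: i v => [|i IHi] v; first by rewrite add0n => ->; exists v.
rewrite addSn => dv; have [|w _ dw] := @dist_pred u v; first by rewrite -dv.
by apply: (IHi w); apply/eq_add_S; rewrite dv dw.
Qed.

(** Raising the threshold from [k] to [k.+1] removes at least one vertex: if some vertex lies beyond
    [k.+1], another lies at distance exactly [k.+1]. *)
Lemma card_dist_gt u k : #|[set x | k < dist e u x]| <= #|T| - k.+1.
Proof.
elim: k => [|k IHk].
  rewrite subn1 -(cardsC1 u); apply/subset_leq_card/subsetP => x.
  by rewrite !inE; apply: contraTneq => ->; rewrite dist_self.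
have [->|[v]] := set_0Vmem [set x | k.+1 < dist e u x]; first by rewrite cards0.
rewrite inE => /ltnW /dist_attained[w dw].
suff /proper_card lt_card :
    [set x | k.+1 < dist e u x] \proper [set x | k < dist e u x].
  by rewrite subnS; move: (leq_trans lt_card IHk); case: (_ - _).
apply/properP; split.
  by apply/subsetP => x; rewrite !inE; apply: ltnW.
by exists w; rewrite !inE dw ?ltnn.
Qed.

Lemma transmission_le u : transmission e u <= 'C(#|T|, 2).
Proof.
have dist_le x : dist e u x <= #|T|.
  by rewrite -[leqRHS](size_iota 0) /dist find_size.
(* Layer-cake form: exchanging the sums turns the transmission into a sum over [k] of the number of
   vertices farther than [k]. *)
have distE x : dist e u x = \sum_(k < #|T|) (k < dist e u x).
  transitivity (\sum_(k < #|T| | k < dist e u x) 1); last exact: big_mkcond.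
  by rewrite (big_ord_narrow (dist_le x)) sum1_card card_ord.
rewrite /transmission (eq_bigr _ (fun x _ => distE x)) exchange_big /=.
(* The layer bounds run down from [#|T| - 1] to [0]; reversing the index matches them termwise with
   [0 + 1 + ...]. *)
rewrite -bin2_sum big_mkord (reindex_inj rev_ord_inj) /=.
apply: leq_sum => k _; have := card_dist_gt u (rev_ord k).
rewrite -sum1dep_card big_mkcond => /leq_trans -> //=.
by rewrite subnSK ?subKn // ltnW.
Qed.

Lemma card_edges_ge : symmetric e -> #|T| <= #|edges e|.+1.
Proof.
move=> e_sym; have [->//|/card_gt0P[r _]] := posnP #|T|.
(* [p] is a parent map towards the root [r]; its value at [r] is arbitrary. *)
have /fin_all_exists[p pP] v : exists w, v != r ->
    e w v /\ dist e r v = (dist e r w).+1.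
  have [->|nvr] := eqVneq v r; first by exists r.
  by have [w] := dist_pred (dist_gt0 nvr); exists w.
apply: leq_trans (leqSpred _) _.
rewrite ltnS -(cardsC1 r) -(card_in_imset (f := fun v => [set v; p v])).
  apply/subset_leq_card/subsetP => _ /imsetP[v + ->].
  by rewrite !inE => /pP[evp _]; rewrite in_edges // e_sym.
move=> v v'; rewrite !inE => /pP[_ dv] /pP[_ dv'] /setP E.
move: (E v) (E v'); rewrite !inE !eqxx /=.
(* Two distinct vertices giving the same edge would be parents of each other, so each would be
   farther from [r] than the other. *)
case: eqVneq => //= _ /esym/eqP vp /eqP vp'.
by rewrite -vp in dv'; rewrite -vp' in dv; lia.
Qed.

End ConnectedGraph.

Theorem theorem1 (R : realType) (T : finType) (e : rel T) (n : nat)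
  (e_sym : symmetric e) (e_irr : irreflexive e) (e_conn : connected_graph e)
  (card_T : #|T| = n) (n_ge4 : (4 <= n)%N) :
  2 * Num.sqrt (n%:R / (n%:R - 1)) <= sum_balaban R e.
Proof.
rewrite /sum_balaban card_T.
have := card_edges_ge e_conn e_sym; rewrite card_T.
move card_e: #|edges e| => m m_ge.
have n4 : 4 <= n%:R :> R by rewrite (ler_nat R 4).
have mn : n%:R <= m%:R + 1 :> R by rewrite natr1 ler_nat.
set N : R := n%:R in n4 mn *; set M : R := m%:R in mn *.
have NN_gt0 : 0 < N * (N - 1) by apply: mulr_gt0; lra.
set s := Num.sqrt (N * (N - 1)).
have s_gt0 : 0 < s by rewrite sqrtr_gt0.
have sumE : M / s <=
    \sum_(A in edges e) 1 / Num.sqrt (\sum_(x in A) transmission e x)%N%:R.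
  rewrite /M -card_e mulr_natl -sumr_const; apply: ler_sum => A.
  case/imsetP => -[u v]; rewrite inE /= => euv ->.
  rewrite sum_edge_transmission // div1r.
  have nuv : v != u by apply: contraTneq euv => ->; rewrite e_irr.
  have w_gt0 : (0 < transmission e u + transmission e v)%N.
    rewrite addn_gt0 /transmission (bigD1 v) //=.
    by rewrite addn_gt0 dist_gt0.
  rewrite lef_pV2 ?posrE ?sqrtr_gt0 ?ltr0n //.
  have n_ge1 : (1 <= n)%N by lia.
  apply: ler_wsqrtr; rewrite /N -(natrB _ n_ge1) subn1 -natrM ler_nat.
  have := transmission_le e_conn u; have := transmission_le e_conn v.
  (* This yields [n * (n - 1) = 2 * 'C(n, 2)], the bound for two transmissions together. *)
  rewrite card_T; have := mul_bin_diag n 1.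
  rewrite bin1; nia.
have M_ge0 : 0 <= M by rewrite ler0n.
have k_gt0 : 0 < M - N + 2 by lra.
apply: (le_trans _ (ler_wpM2l _ sumE)); last by rewrite divr_ge0 // ltW.
(* Since [s ^+ 2 = N * (N - 1)], the target becomes [2 * (N / s)], and the factor [1 / s] cancels
   from both sides. *)
have -> : N / (N - 1) = (N / s) ^+ 2.
  rewrite expr_div_n sqr_sqrtr; last exact: ltW.
  by field; apply/andP; split; apply: lt0r_neq0; lra.
rewrite sqrtr_sqr ger0_norm; last by rewrite divr_ge0 // ?ltW //; lra.
rewrite mulrA [leRHS]mulrA ler_pM2r ?invr_gt0 //.
rewrite mulrAC ler_pdivlMr //.
have : 0 <= (M - N) ^+ 2 + N * (N - 4).
  by rewrite addr_ge0 ?sqr_ge0 // mulr_ge0 //; lra.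
lra.
Qed.
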